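(* Assume that $P(T)\in L^1$ and $P^n(T)\in L^1$ for all $n\ge1$. Then there is a constant $C>0$, independent of $n$, such that $$|E(P(T))-E(P^n(T))|\le C\qquad\text{for all } n\ge 1.$$
   Context: Let $T>0$ be fixed and let $(\Omega,\mathcal F,\mathbb F=(\mathcal F_t)_{t\in[0,T]},P)$ be a filtered probability space satisfying the usual conditions. $S=(S_t)_{t\in[0,T]}$ is a semimartingale with $S>0$ and $S_->0$ which is a local martingale under $P$ (jumps are allowed). $L^p$ means $L^p(\Omega,\mathcal F,P)$ and $E$ is expectation under $P$. For $n\ge1$ let $t_i=iT/n$, $i=0,\dots,n$. Define $P^n(T)=\sum_{i=1}^n\left(\ln\frac{S_{t_i}}{S_{t_{i-1}}}\right)^2$ and $P(T)=[\ln S,\ln S]_T$ (quadratic variation). *)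

(* Defs.v *)
(* MathComp-Analysis *)
From HB Require Import structures.
From mathcomp Require Import all_boot all_order all_algebra.
From mathcomp Require Import all_classical all_reals all_analysis.
Set Implicit Arguments.
Unset Strict Implicit.
Unset Printing Implicit Defensive.
Import Order.TTheory GRing.Theory Num.Theory.
Import numFieldNormedType.Exports.
Local Open Scope classical_set_scope.
Local Open Scope ring_scope.

(* Time runs through [0, T]. Processes X : R -> Omega -> R and filtrations
   F : R -> set (set Omega) are total functions of a real time, but their values
   outside [0, T] are never used. Path properties are required almost surely,
   with a null set that does not depend on the time. *)

Section filtrations.
Context {d} {Omega : measurableType d} {R : realType}.
Variables (P : probability Omega R) (T : R) (F : R -> set (set Omega)).

Definition is_filtration :=
  [/\ forall t, 0 <= t <= T -> sigma_algebra [set: Omega] (F t),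
      forall t, 0 <= t <= T -> F t `<=` measurable
    & forall s t, 0 <= s -> s <= t -> t <= T -> F s `<=` F t].

(* Since F 0 consists of measurable sets, the second clause also makes
   (Omega, P) a complete probability space. *)
Definition usual_conditions :=
  (forall t, 0 <= t < T -> F t = \bigcap_(s in `]t, T]%classic) F s) /\
  (forall N : set Omega, P.-negligible N -> F 0 N).

Definition measurable_wrt (G : set (set Omega)) (Y : Omega -> R) :=
  forall B : set R, measurable B -> G (Y @^-1` B).

Definition adapted (X : R -> Omega -> R) :=
  forall t, 0 <= t <= T -> measurable_wrt (F t) (X t).

Definition stopping_time (tau : Omega -> \bar R) :=
  (forall w, (0 <= tau w)%E) /\
  (forall t, 0 <= t <= T -> F t [set w | (tau w <= t%:E)%E]).

End filtrations.

Section processes.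
Context {d} {Omega : measurableType d} {R : realType}.
Variables (P : probability Omega R) (T : R) (F : R -> set (set Omega)).
Implicit Types X M A Q : R -> Omega -> R.

(* Y is a version of E[Z | G] *)
Definition is_cond_expectation (G : set (set Omega)) (Z Y : Omega -> R) :=
  [/\ measurable_wrt G Y, P.-integrable setT (EFin \o Y)
    & forall B, G B -> (\int[P]_(w in B) (Y w)%:E = \int[P]_(w in B) (Z w)%:E)%E].

Definition martingale M :=
  [/\ adapted T F M,
      forall t, 0 <= t <= T -> P.-integrable setT (EFin \o M t)
    & forall s t, 0 <= s -> s <= t -> t <= T ->
        is_cond_expectation (F s) (M t) (M s)].

Definition cadlag_path (x : R -> R) :=
  (forall t, 0 <= t < T -> x s @[s --> t^'+] --> x t) /\
  (forall t, 0 < t <= T -> cvg (x s @[s --> t^'-])).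

Definition cadlag X := {ae P, forall w, cadlag_path (X ^~ w)}.

Definition left_limit X (t : R) (w : Omega) : R := lim (X s w @[s --> t^'-]).

(* X_{t /\ tau} *)
Definition stopped X (tau : Omega -> \bar R) (t : R) (w : Omega) : R :=
  X (fine (mine t%:E (tau w))) w.

(* The factor 1_{tau_n > 0} is the usual device that lets X_0 be an arbitrary
   F_0-measurable, possibly non-integrable, random variable. On a finite horizon
   "tau_n increases to infinity" means that tau_n >= T for all large n, and every
   martingale on [0, T] is uniformly integrable. *)
Definition local_martingale X :=
  [/\ adapted T F X, cadlag X &
      exists tau : nat -> Omega -> \bar R,
        [/\ forall n, stopping_time T F (tau n),
            {ae P, forall w, forall n, (tau n w <= tau n.+1 w)%E},
            {ae P, forall w, exists n, (T%:E <= tau n w)%E}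
          & forall n, martingale (fun t w =>
              stopped X (tau n) t w * \1_[set w | (0 < tau n w)%E] w)]].

Definition finite_variation A :=
  {ae P, forall w, bounded_variation 0 T (A ^~ w)}.

Definition semimartingale X :=
  [/\ adapted T F X, cadlag X &
      exists M A,
        [/\ local_martingale M, adapted T F A, cadlag A, finite_variation A
          & {ae P, forall w, forall t, 0 <= t <= T -> X t w = M t w + A t w}]].

(* As in itv_partition, the points of a partition of [a, b] are a :: s, where the
   last element of a :: s is b. *)
Definition mesh (a b : R) (s : seq R) : R :=
  \big[Num.max/0]_(0 <= i < size s) (nth b (a :: s) i.+1 - nth b (a :: s) i).

Definition sum_sq_increments (a b : R) (x : R -> R) (s : seq R) : R :=
  \sum_(0 <= i < size s)
    (x (nth b (a :: s) i.+1) - x (nth b (a :: s) i)) ^+ 2.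

Definition cvg_in_probability (Y : nat -> Omega -> R) (Z : Omega -> R) :=
  forall e : R, 0 < e ->
    P [set w | e <= `|Y k w - Z w|] @[k --> \oo] --> 0%E.

(* Q is a version of [X, X], normalized by [X, X]_0 = 0: for every t, the sums of
   squared increments of X along any deterministic partitions of [0, t] whose mesh
   tends to 0 converge to Q_t in probability. *)
Definition is_quadratic_variation X Q :=
  [/\ adapted T F Q, cadlag Q &
      forall t, 0 <= t <= T -> forall s : nat -> seq R,
        (forall k, itv_partition 0 t (s k)) ->
        mesh 0 t (s k) @[k --> \oo] --> 0 ->
        cvg_in_probability
          (fun k w => sum_sq_increments 0 t (X ^~ w) (s k)) (Q t)].

Definition realized_variance X (n : nat) (w : Omega) : R :=
  \sum_(1 <= i < n.+1)
    (ln (X (i%:R * T / n%:R) w / X (i.-1%:R * T / n%:R) w)) ^+ 2.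

End processes.

(* Main.v *)
(* Write Y_j = ln (S_{t_j} / S_0) and u_j = Y_{j+1} - Y_j. A nonnegative local
   martingale is a supermartingale, so E[exp u_j | F_{t_j}] <= 1. With
   phi(y) = 12 y + 2 y |y| and c(y) = 12 + 4 |y| the pointwise inequality
     u^2 <= phi(y) - phi(y + u) + c(y) (e^u - 1)
   telescopes to E P^n(T) <= - E phi(Y_n) <= 6 + 8 E P^1(T), uniformly in n; the
   term E P(T) is a finite constant. The large negative jumps of ln S, for which
   e^u - 1 stays bounded, are the reason for the quadratic part of phi. *)
Require Import Defs.
From HB Require Import structures.
From mathcomp Require Import all_boot all_order all_algebra.
From mathcomp Require Import all_classical all_reals all_analysis.
From mathcomp Require Import measurable_realfun ring lra.
Set Implicit Arguments.
Unset Strict Implicit.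
Unset Printing Implicit Defensive.
Import Order.TTheory GRing.Theory Num.Theory.
Import numFieldNormedType.Exports.
Local Open Scope classical_set_scope.
Local Open Scope ring_scope.

(** * Integrals of functions weighted by a factor measurable for a sub-sigma-algebra *)

Section subalgebra.
Context {d} {Omega : measurableType d} {R : realType}.
Variables (mu : {measure set Omega -> \bar R}) (G : set (set Omega)).
Hypothesis sG : sigma_algebra [set: Omega] G.
Hypothesis Gm : G `<=` measurable.
(** The sample space with [G] as its sigma-algebra: [G]-measurability becomes [measurable_fun], and
    approximation by simple functions yields [G]-measurable ones. *)
Local Notation OmegaG := (g_sigma_algebraType G).

Lemma measurable_sub_sigma_algebra (B : set OmegaG) : measurable B -> G B.
Proof. by rewrite /measurable/= sigma_algebra_id. Qed.

Lemma measurable_wrtP (f : Omega -> R) :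
  measurable_wrt G f <-> measurable_fun [set: OmegaG] (f : OmegaG -> R).
Proof.
split=> [mf _ B mB|mf B mB].
  by rewrite setTI; apply: sub_gen_smallest; exact: mf.
by apply: measurable_sub_sigma_algebra; rewrite -[_ @^-1` _]setTI; exact: mf.
Qed.

Lemma measurable_sub_fun d' (T' : measurableType d') (f : OmegaG -> T') :
  measurable_fun setT f -> measurable_fun [set: Omega] (f : Omega -> T').
Proof.
move=> mf _ B mB; apply: Gm; apply: measurable_sub_sigma_algebra.
exact: mf.
Qed.

Import HBNNSimple.

(** The level sets of [h] belong to [G], so the integral depends on [Z] only through its integrals
    over members of [G]. *)
Lemma integral_nnsfun_sub (h : {nnsfun OmegaG >-> R}) (Z : Omega -> \bar R) :
  measurable_fun setT Z -> (forall w, (0 <= Z w)%E) ->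
  (\int[mu]_w ((h w)%:E * Z w) =
   \sum_(r \in range h) (r%:E * \int[mu]_(w in h @^-1` [set r]) Z w))%E.
Proof.
move=> mZ Z0.
pose B r : set Omega := h @^-1` [set r].
have mB r : measurable (B r).
  by apply: Gm; apply: measurable_sub_sigma_algebra; exact: measurable_funPTI.
have hZ r w : ((r * \1_(B r) w)%:E * Z w = r%:E * (Z \_ (B r)) w)%E.
  by rewrite indicE patchE; case: ifPn => _; rewrite ?mulr1// mulr0 mul0e mule0.
have mZr r : measurable_fun setT (Z \_ (B r)).
  by apply/(measurable_restrictT _ _).1 => //; exact: measurable_funTS.
transitivity (\int[mu]_w
    (\sum_(r \in range h) ((r * \1_(h @^-1` [set r]) w)%:E * Z w)))%E.
  apply: eq_integral => w _; rewrite fimfunE -fsumEFin// ge0_mule_fsuml// => r.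
  exact: nnfun_muleindic_ge0.
rewrite ge0_integral_fsum//; last 2 first.
- move=> r; under eq_fun do rewrite hZ.
  exact: measurable_funeM.
- by move=> r w _; rewrite mule_ge0// nnfun_muleindic_ge0.
apply: eq_fsbigr => r; rewrite inE => -[w _ <-].
rewrite [in RHS]integral_mkcond -ge0_integralZl//.
+ exact: eq_integral.
+ exact: mZr.
+ by move=> x _; exact: erestrict_ge0.
+ by rewrite lee_fin.
Qed.

(** The hypothesis on members of [G] is a weak form of E[Z1 | G] <= E[Z2 | G] in which infinite
    integrals are allowed. It passes to simple weights by linearity, then to [f] by monotone
    convergence. *)
Lemma ge0_le_integral_sub (f : OmegaG -> R) (Z1 Z2 : Omega -> R) :
  measurable_fun setT f -> (forall w, 0 <= f w) ->
  measurable_fun setT Z1 -> (forall w, 0 <= Z1 w) ->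
  measurable_fun setT Z2 -> (forall w, 0 <= Z2 w) ->
  (forall B, G B ->
    (\int[mu]_(w in B) (Z1 w)%:E <= \int[mu]_(w in B) (Z2 w)%:E)%E) ->
  (\int[mu]_w (f w * Z1 w)%:E <= \int[mu]_w (f w * Z2 w)%:E)%E.
Proof.
move=> mf f0 mZ1 Z10 mZ2 Z20 Z12.
have mEf : measurable_fun setT (EFin \o f) by exact/measurable_EFinP.
pose h := nnsfun_approx measurableT mEf.
have mh n : measurable_fun [set: Omega] (EFin \o h n).
  by apply: measurable_sub_fun; exact/measurable_EFinP.
have hnd w m n : (m <= n)%N -> h m w <= h n w.
  by move=> mn; exact/lefP/nd_nnsfun_approx.
have hlim (Z : Omega -> R) : measurable_fun setT Z ->
    (forall w, 0 <= Z w) ->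
    (\int[mu]_w ((h n w)%:E * (Z w)%:E) @[n --> \oo] -->
     \int[mu]_w (f w * Z w)%:E)%E.
  move=> mZ Z0.
  rewrite (_ : (\int[mu]_w (f w * Z w)%:E)%E =
      (\int[mu]_w limn (fun n => (h n w)%:E * (Z w)%:E))%E); last first.
    apply: eq_integral => w _; rewrite EFinM; apply/esym/cvg_lim => //.
    apply: cvgeZr => //; apply: cvg_nnsfun_approx => [x _|//].
    by rewrite lee_fin.
  apply: (@cvg_monotone_convergence _ _ _ mu setT measurableT
    (fun n w => (h n w)%:E * (Z w)%:E)%E).
  - by move=> n; apply: emeasurable_funM; [exact: mh|exact/measurable_EFinP].
  - by move=> n w _; rewrite mule_ge0// lee_fin.
  - by move=> w _ m n mn; rewrite lee_wpmul2r ?lee_fin//; exact: hnd.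
rewrite -(cvg_lim _ (hlim _ mZ1 Z10))// -(cvg_lim _ (hlim _ mZ2 Z20))//.
apply: lee_lim.
- by apply/cvg_ex; eexists; exact: hlim.
- by apply/cvg_ex; eexists; exact: hlim.
apply: nearW => n; rewrite !integral_nnsfun_sub//; [|exact/measurable_EFinP..].
apply: lee_fsum => // r [w _ <-].
rewrite lee_wpmul2l ?lee_fin//; apply: Z12.
exact: measurable_sub_sigma_algebra.
Qed.

End subalgebra.

(** * The pointwise inequality for the potential *)

Section potential.
Context {R : realType}.
Implicit Types u w y : R.

(** Square e^(u/2) >= 1 + u/2; the condition on u makes the right side nonnegative. *)
Lemma expR_halfsq u : -2 <= u -> 1 + u + u ^+ 2 / 4 <= expR u.
Proof.
move=> u2; rewrite [in leRHS](_ : u = u / 2 + u / 2); last lra.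
rewrite expRD -expr2 (_ : 1 + u + u ^+ 2 / 4 = (1 + u / 2) ^+ 2); last by field.
rewrite lerXn2r ?expR_ge1Dx// nnegrE ?expR_ge0//; lra.
Qed.

(** The lower bound w^2 / (4 + w) for e^(-w) - 1 + w is quadratic near 0 and linear at infinity. Up
    to w = 2 it follows from [expR_halfsq]; beyond, e^(-w) > 0 is enough. *)
Lemma expRN_rational_ge w : 0 <= w ->
  w ^+ 2 <= (4 + w) * (expR (- w) - 1 + w).
Proof.
move=> w0; have [w2|w2] := leP w 2.
  have := @expR_halfsq (- w); rewrite lerN2 sqrrN => /(_ w2).
  set e := expR _; nra.
have := expR_gt0 (- w); set e := expR _; nra.
Qed.

Definition potential y := 12 * y + 2 * (y * `|y|).

Definition weight y := 12 + 4 * `|y|.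

(* [weight] has to be the derivative of [potential]: compare the first-order
   terms at u = 0. *)
Lemma potential_step y u :
  u ^+ 2 + potential (y + u) + weight y <= potential y + weight y * expR u.
Proof.
rewrite /potential /weight.
have [u0|u0] := leP 0 u.
  have := @expR_halfsq u; rewrite (le_trans _ u0)// => /(_ isT).
  set e := expR u => ue.
  (* The derivative [weight] is 4-Lipschitz, so the first-order Taylor remainder of [potential] is
     at most 2 u^2. With the extra u^2 this makes 3 u^2, which the constant 12 pays for. *)
  have cue : 12 * (u ^+ 2 / 4) <= (12 + 4 * `|y|) * (e - 1 - u).
    have := normr_ge0 y; nra.
  have [y0|y0] := leP 0 y.
    rewrite (ger0_norm y0) ger0_norm in cue *; nra.
  rewrite (ltr0_norm y0) in cue *.
  have [z0|z0] := leP 0 (y + u).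
    rewrite (ger0_norm z0); nra.
  rewrite (ltr0_norm z0); nra.
have w0 : 0 <= - u by lra.
have := expRN_rational_ge w0; rewrite opprK sqrrN.
have := expR_ge1Dx u.
set e := expR u => e1 ue.
have [y0|y0] := leP y 0.
  (* On the concave branch the Taylor remainder is -2 u^2, which absorbs u^2 by itself; only e^u >=
     1 + u remains to be used. *)
  have ce : 0 <= (12 - 4 * y) * (e - 1 - u) by apply: mulr_ge0; lra.
  rewrite (ler0_norm y0) ler0_norm; last lra.
  have := sqr_ge0 u; lra.
rewrite (gtr0_norm y0).
have [z0|z0] := leP 0 (y + u).
  (* Here y >= -u gives 12 + 4 y >= 3 (4 - u), so [expRN_rational_ge] covers the required 3 u^2. *)
  rewrite (ger0_norm z0); nra.
rewrite (ltr0_norm z0).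
(* After multiplication by 4 - u, expRN_rational_ge leaves the sum
   16 (u + y)^2 - u (u + 2 y)^2, which is nonnegative since u < 0. *)
have : 0 <= (4 - u) * ((12 + 4 * y) * (e - 1 - u)
    - (- u ^+ 2 - 4 * y ^+ 2 - 8 * y * u)).
  have : (12 + 4 * y) * u ^+ 2 <= (12 + 4 * y) * ((4 - u) * (e - 1 - u)).
    by apply: ler_wpM2l => //; lra.
  have : 0 <= 16 * (u + y) ^+ 2 - u * (u + 2 * y) ^+ 2.
    have := sqr_ge0 (u + y); have := sqr_ge0 (u + 2 * y); nra.
  lra.
rewrite pmulr_rge0; last lra.
lra.
Qed.

Lemma weight_ge0 y : 0 <= weight y.
Proof. by rewrite addr_ge0// mulr_ge0. Qed.

(** For y < 0 the difference of the two sides is exactly 6 (y + 1)^2. *)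
Lemma oppr_potential_le y : - potential y <= 6 + 8 * y ^+ 2.
Proof.
rewrite /potential; have [y0|y0] := leP 0 y.
  rewrite ger0_norm//; nra.
have := sqr_ge0 (y + 1); rewrite ltr0_norm//; nra.
Qed.

End potential.

(** * Nonnegative local martingales are supermartingales *)

Section supermartingale.
Context {d} {Omega : measurableType d} {R : realType}.
Variables (P : probability Omega R) (T : R) (F : R -> set (set Omega)).
Variable X : R -> Omega -> R.
Hypothesis FT : is_filtration T F.
Hypothesis X_locmart : local_martingale P T F X.
Hypothesis X_ge0 : {ae P, forall w, forall t, 0 <= t <= T -> 0 <= X t w}.

Lemma adapted_measurable t : 0 <= t <= T -> measurable_fun setT (X t).
Proof.
move=> tT; case: FT => sF Fm _; case: X_locmart => adX _ _.
apply: (measurable_sub_fun (sF _ tT) (Fm _ tT)).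
by apply/(measurable_wrtP (sF _ tT)); exact: adX.
Qed.

Lemma ge0_stopped (tau : Omega -> \bar R) t : stopping_time T F tau ->
  0 <= t <= T -> {ae P, forall w, 0 <= stopped X tau t w}.
Proof.
move=> [tau0 _] /andP[t0 tT]; apply: filterS X_ge0 => w; apply.
have [m0 mt] : (0 <= mine t%:E (tau w))%E /\ (mine t%:E (tau w) <= t%:E)%E.
  by rewrite le_min tau0 lee_fin t0 ge_min lexx.
have mfin : mine t%:E (tau w) \is a fin_num.
  by rewrite ge0_fin_numE// (le_lt_trans mt)// ltry.
by rewrite fine_ge0//= -lee_fin fineK// (le_trans mt)// lee_fin.
Qed.

Lemma stopped_gt (tau : Omega -> \bar R) t w :
  (t%:E < tau w)%E -> stopped X tau t w = X t w.
Proof. by move=> ttau; rewrite /stopped min_l// ltW. Qed.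

(* Restricting to tau > s replaces X_{s /\ tau} by X_s, so that no integrability
   of X_s is needed. *)
Lemma le_integral_stopped (tau : Omega -> \bar R) (s t : R) (B : set Omega) :
  stopping_time T F tau ->
  martingale P T F
    (fun r w => stopped X tau r w * \1_[set w | (0 < tau w)%E] w) ->
  0 <= s -> s <= t -> t <= T -> F s B ->
  (\int[P]_(w in B `&` [set w | (s%:E < tau w)%E])
      `|stopped X tau t w * \1_[set w | (0 < tau w)%E] w|%:E
    <= \int[P]_(w in B) `|X s w|%:E)%E.
Proof.
move=> tauF; set M := (fun r w => _ * _) => -[adM intM condM] s0 st tT FB.
have sT : 0 <= s <= T by rewrite s0 (le_trans st).
have tT' : 0 <= t <= T by rewrite (le_trans s0).
case: FT => sF Fm _.
have FA : F s [set w | (s%:E < tau w)%E].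
  have [_ /(_ _ (tauF.2 s sT)) + _] := sF s sT.
  rewrite setTD; congr (F s _); apply/seteqP; split=> w /=.
    by move/negP; rewrite -ltNge.
  by rewrite ltNge => /negP.
set A := [set w | _] in FA *.
have FBA : F s (B `&` A).
  apply: (measurable_sub_sigma_algebra (sF s sT)).
  by apply: measurableI; exact: sub_gen_smallest.
have mBA := Fm s sT _ FBA.
have mB := Fm s sT _ FB.
have mM r : 0 <= r <= T -> measurable_fun setT (EFin \o M r).
  by move=> rT; have /integrableP[] := intM r rT.
have mnM r : 0 <= r <= T -> measurable_fun (B `&` A) (fun w => `|M r w|%:E).
  move=> rT; apply: measurable_funTS; apply/measurable_EFinP.
  by apply: measurableT_comp => //; apply/measurable_EFinP; exact: mM.
have nX : measurable_fun setT (fun w => `|X s w|%:E).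
  apply/measurable_EFinP; apply: measurableT_comp => //.
  exact: adapted_measurable.
(* The absolute value makes the integrand nonnegative everywhere; since it changes [M t] only on a
   null set, the martingale identity on the [F s]-set [B] intersected with [A] still applies. *)
have -> : (\int[P]_(w in B `&` A) `|M t w|%:E =
           \int[P]_(w in B `&` A) (M t w)%:E)%E.
  apply: ae_eq_integral => //.
  - exact: mnM.
  - by apply: measurable_funTS; exact: mM.
  apply: filterS (ge0_stopped tauF tT') => w Xw _ /=.
  by rewrite ger0_norm// mulr_ge0.
have [_ _ /(_ _ FBA) <-] := condM s t s0 st tT.
apply: (@le_trans _ _ (\int[P]_(w in B `&` A) `|M s w|%:E)%E).
  apply: (le_trans (lee_abs _)); apply: le_abse_integral => //.
  by apply: measurable_funTS; exact: mM.
rewrite (_ : (\int[P]_(w in B `&` A) `|M s w|%:E =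
              \int[P]_(w in B `&` A) `|X s w|%:E)%E); last first.
  apply: eq_integral => w; rewrite inE => -[_ Aw].
  rewrite /M stopped_gt// indicE mem_set ?mulr1//=.
  by rewrite (le_lt_trans _ Aw)// lee_fin.
by apply: ge0_subset_integral => //; exact: measurable_funTS.
Qed.

(** The supermartingale property tested against an arbitrary nonnegative [F s]-measurable weight,
    with infinite values allowed: localize, compare on each {tau_k > s}, and let k grow by Fatou. *)
Lemma ge0_local_martingale_le (s t : R) (f : Omega -> R) :
  0 <= s -> s < t -> t <= T -> measurable_wrt (F s) f -> (forall w, 0 <= f w) ->
  (\int[P]_w (f w * `|X t w|)%:E <= \int[P]_w (f w * `|X s w|)%:E)%E.
Proof.
move=> s0 st tT mf f0.
have sT : 0 <= s <= T by rewrite s0 (le_trans (ltW st)).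
have tT' : 0 <= t <= T by rewrite (le_trans s0)// ltW.
have [sF Fm _] := FT.
have [_ _ [tau [tauF tau_nd tau_T martM]]] := X_locmart.
pose A k := [set w | (s%:E < tau k w)%E].
pose Z k w := `|stopped X (tau k) t w * \1_[set w | (0 < tau k w)%E] w|
              * \1_(A k) w.
have mA k : measurable (A k).
  have /measurableC := Fm s sT _ ((tauF k).2 s sT).
  congr measurable; apply/seteqP; split=> w /=.
    by move/negP; rewrite -ltNge.
  by rewrite /A/= ltNge => /negP.
have mM k : measurable_fun setT
    (fun w => stopped X (tau k) t w * \1_[set w | (0 < tau k w)%E] w).
  have [_ /(_ t tT')/integrableP[+ _] _] := martM k.
  by move=> /measurable_EFinP.
have mZ k : measurable_fun setT (Z k).
  apply: measurable_funM; first exact: measurableT_comp.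
  exact: measurable_indic.
have Z0 k w : 0 <= Z k w by rewrite mulr_ge0.
have mf' : measurable_fun setT f.
  apply: (measurable_sub_fun (sF _ sT) (Fm _ sT)).
  exact/(measurable_wrtP (sF _ sT)).
have mX r : 0 <= r <= T -> measurable_fun setT (fun w => `|X r w|).
  by move=> rT; apply: measurableT_comp => //; exact: adapted_measurable.
have fZ k : (\int[P]_w (f w * Z k w)%:E <= \int[P]_w (f w * `|X s w|)%:E)%E.
  apply: (ge0_le_integral_sub (sF s sT) (Fm s sT)) => //.
  - exact/(measurable_wrtP (sF _ sT)).
  - exact: mX.
  move=> B FB.
  apply: le_trans (le_integral_stopped (tauF k) (martM k) s0 (ltW st) tT FB).
  rewrite integral_mkcondr le_eqVlt; apply/orP; left; apply/eqP.
  apply: eq_integral => w _; rewrite patchE /Z [\1_(A k) w]indicE.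
  by case: ifPn => _; rewrite ?mulr1// mulr0.
pose g k w := (f w * Z k w)%:E.
have g0 k w : (0 <= g k w)%E by rewrite lee_fin mulr_ge0.
have mg k : measurable_fun setT (g k).
  by apply/measurable_EFinP; exact: measurable_funM.
apply: (@le_trans _ _ (\int[P]_w limn_einf (g ^~ w))%E).
  apply: ae_ge0_le_integral => //.
  - by move=> w _; rewrite lee_fin mulr_ge0.
  - apply/measurable_EFinP; apply: measurable_funM => //; exact: mX.
  - move=> w _; rewrite limn_einf_lim; apply: lime_ge; first exact: is_cvg_einfs.
    by apply: nearW => n; apply: le_ereal_inf_tmp => _ [k _ <-].
  - apply: measurableT_comp => //; apply: measurable_fun_limn_esup => k.
    exact: measurableT_comp.
  have : {ae P, forall w, forall k, (tau k w <= tau k.+1 w)%E} := tau_nd.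
  move: tau_T; apply: filterS2 => w [n nT] nd _.
  have nT' k : (n <= k)%N -> (T%:E <= tau k w)%E.
    by elim: k => [|k IHk]; rewrite leq_eqVlt => /predU1P[<-//|//];
       rewrite ltnS => /IHk /le_trans; apply.
  rewrite (cvg_limn_einf_sup (l := (f w * `|X t w|)%:E)) ?lexx//.
  apply: cvg_near_cst; exists n => //= k /= /nT' Tk.
  rewrite /g /Z /stopped min_l/=; last by rewrite (le_trans _ Tk)// lee_fin.
  (* The strict inequality s < t <= T <= tau_k puts the path in [A k], so [g k w] is eventually
     constant in k. *)
  have As : A k w by rewrite /A/= (lt_le_trans _ Tk)// lte_fin (lt_le_trans st).
  have tau0 : (0 < tau k w)%E by rewrite (le_lt_trans _ As)// lee_fin.
  by rewrite !indicE (mem_set As) (@mem_set _ [set w | (0 < tau k w)%E]) ?mulr1.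
apply: (le_trans (fatou _ measurableT _ _)) => //.
rewrite limn_einf_lim; apply: lime_le; first exact: is_cvg_einfs.
apply: nearW => n; apply: le_trans (fZ n).
by apply: ereal_inf_lbound; exists n => /=.
Qed.

End supermartingale.

(** * Telescoping along a deterministic sequence *)

Section discrete_path.
Context {R : realType}.
Implicit Types (n : nat) (y : nat -> R).

(** Sum of [potential_step] over j. The weights stand on both sides, instead of being subtracted, so
    that every term is nonnegative and can be integrated separately. *)
Lemma sum_sq_increments_potential n y : y 0%N = 0 ->
  \sum_(j < n) (y j.+1 - y j) ^+ 2 + \sum_(j < n) weight (y j) <=
  (6 + 8 * y n ^+ 2) + \sum_(j < n) weight (y j) * expR (y j.+1 - y j).
Proof.
(* The induction needs the exact telescoped term [- potential (y n)]; the quadratic bound is applied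
   only at the end. *)
move=> y0; apply: (@le_trans _ _
    (- potential (y n) + \sum_(j < n) weight (y j) * expR (y j.+1 - y j)));
  last by rewrite lerD2r oppr_potential_le.
elim: n => [|n IHn]; first by rewrite !big_ord0 y0 /potential !mul0r !mulr0; lra.
rewrite !big_ord_recr/=.
have := potential_step (y n) (y n.+1 - y n).
rewrite subrKC; lra.
Qed.

(** Every increment v satisfies |v| <= 1 + v^2. This makes the weights integrable once the sum of
    squares is. *)
Lemma le_normr_sum_sq_increments n y j : y 0%N = 0 -> (j <= n)%N ->
  `|y j| <= n%:R + \sum_(i < n) (y i.+1 - y i) ^+ 2.
Proof.
move=> y0; elim: n j => [j|n IHn j].
  by rewrite leqn0 => /eqP ->; rewrite y0 normr0 big_ord0 addr0.
rewrite big_ord_recr/= -natr1.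
have := sqr_ge0 (y n.+1 - y n); set v := _ ^+ 2.
rewrite leq_eqVlt => v0 /predU1P[->|]; last by rewrite ltnS => /IHn; lra.
have := IHn n (leqnn n).
have := ler_normD (y n.+1 - y n) (y n); rewrite subrK.
suff : `|y n.+1 - y n| <= 1 + v by lra.
rewrite /v -real_normK ?num_real//.
have := sqr_ge0 (`|y n.+1 - y n| - 1); have := normr_ge0 (y n.+1 - y n); nra.
Qed.

End discrete_path.

Lemma ge0_integralD_sum d (Omega : measurableType d) (R : realType)
    (mu : {measure set Omega -> \bar R}) n (a : Omega -> R)
    (b : 'I_n -> Omega -> R) :
  measurable_fun setT a -> (forall w, 0 <= a w) ->
  (forall j, measurable_fun setT (b j)) -> (forall j w, 0 <= b j w) ->
  (\int[mu]_w (a w + \sum_(j < n) b j w)%:E =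
   \int[mu]_w (a w)%:E + \sum_(j < n) \int[mu]_w (b j w)%:E)%E.
Proof.
move=> ma a0 mb b0; under eq_integral do rewrite EFinD.
rewrite ge0_integralD//; last 4 first.
- by move=> w _; rewrite lee_fin.
- exact/measurable_EFinP.
- by move=> w _; rewrite lee_fin sumr_ge0.
- by apply/measurable_EFinP; exact: measurable_sum.
under [in X in (_ + X)%E]eq_integral do rewrite -sumEFin.
rewrite ge0_integral_sum// => [j|j w _]; first exact/measurable_EFinP.
by rewrite lee_fin.
Qed.

(** * Expected squared log-increments along a finite grid *)

Section log_increments.
Context {d} {Omega : measurableType d} {R : realType}.
Variables (P : probability Omega R) (T : R) (F : R -> set (set Omega)).
Variable S : R -> Omega -> R.
Hypothesis FT : is_filtration T F.
Hypothesis S_locmart : local_martingale P T F S.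
Hypothesis S_gt0 : {ae P, forall w, forall t, 0 <= t <= T -> 0 < S t w}.
Local Notation L t w := (ln (S t w)).

Lemma measurable_log t : 0 <= t <= T -> measurable_fun setT (fun w => L t w).
Proof.
move=> tT; apply: measurableT_comp (adapted_measurable FT S_locmart tT).
exact: measurable_ln.
Qed.

(** Since e^(L_t - L_s) = S_t / S_s almost surely, this is the supermartingale inequality for S with
    weight c(L_s - L_0) / S_s. *)
Lemma integral_expR_increment_le (s t : R) (c : R -> R) :
  0 <= s -> s < t -> t <= T -> measurable_fun setT c -> (forall y, 0 <= c y) ->
  (\int[P]_w (c (L s w - L 0 w) * expR (L t w - L s w))%:E <=
   \int[P]_w (c (L s w - L 0 w))%:E)%E.
Proof.
move=> s0 st tT mc c0.
have sT : 0 <= s <= T by rewrite s0 (le_trans (ltW st)).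
have tT' : 0 <= t <= T by rewrite (le_trans s0)// ltW.
have T0 : 0 <= (0 : R) <= T by rewrite lexx (le_trans _ tT)// (le_trans s0)// ltW.
have [sF _ Fnd] := FT.
have [adS _ _] := S_locmart.
have ms : measurable_fun setT (fun w => c (L s w - L 0 w)).
  apply: measurableT_comp => //.
  by apply: measurable_funB; exact: measurable_log.
(* [expR (- L s w)] is a version of 1 / S_s that is positive everywhere, also on the null set where
   S_s > 0 may fail. *)
pose f w := c (L s w - L 0 w) * expR (- L s w).
have f0 w : 0 <= f w by rewrite mulr_ge0// expR_ge0.
have Ff : measurable_wrt (F s) f.
  have mlog r : 0 <= r <= s ->
      measurable_fun [set: g_sigma_algebraType (F s)] (fun w => L r w).
    move=> /andP[r0 rs].
    apply: measurableT_comp; first exact: measurable_ln.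
    apply/(measurable_wrtP (sF s sT)) => B mB.
    apply: (Fnd r s) => //; first by case/andP: sT.
    by apply: adS => //; rewrite r0 (le_trans rs)//; case/andP: sT.
  apply/(measurable_wrtP (sF s sT)); apply: measurable_funM.
    apply: measurableT_comp => //.
    by apply: measurable_funB; apply: mlog; rewrite ?lexx ?s0.
  apply: measurableT_comp => //; apply: measurableT_comp => //.
  by apply: mlog; rewrite lexx s0.
have mf : measurable_fun setT f.
  apply: measurable_funM => //; apply: measurableT_comp => //.
  by apply: measurableT_comp => //; exact: measurable_log.
have mS r : 0 <= r <= T -> measurable_fun setT (fun w => (f w * `|S r w|)%:E).
  move=> rT; apply/measurable_EFinP; apply: measurable_funM => //.
  apply: measurableT_comp => //; exact: (adapted_measurable FT S_locmart).
have := ge0_local_martingale_le FT S_locmart _ s0 st tT Ff f0.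
rewrite (_ : (\int[P]_w (f w * `|S t w|)%:E = \int[P]_w
    (c (L s w - L 0 w) * expR (L t w - L s w))%:E)%E); last first.
  apply: ae_eq_integral => //; first exact: mS.
    apply/measurable_EFinP; apply: measurable_funM => //.
    apply: measurableT_comp => //.
    by apply: measurable_funB; exact: measurable_log.
  apply: filterS S_gt0 => w Sw _ /=; have St := Sw t tT'.
  by rewrite expRD lnK ?posrE// /f (gtr0_norm St) -mulrA [S t w * _]mulrC.
rewrite (_ : (\int[P]_w (f w * `|S s w|)%:E = \int[P]_w
    (c (L s w - L 0 w))%:E)%E); last first.
  apply: ae_eq_integral => //; [exact: mS|exact/measurable_EFinP|].
  apply: filterS S_gt0 => w Sw _ /=; have Ss := Sw s sT.
  rewrite /f expRN lnK ?posrE// (gtr0_norm Ss) -mulrA mulVf ?mulr1//.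
  by rewrite gt_eqF.
by apply; apply: filterS S_gt0 => w Sw r /Sw/ltW.
Qed.

(** Integrate the telescoped path inequality, bound each exponential term by
    [integral_expR_increment_le], and cancel the expected weights. *)
Lemma integral_sum_sq_increments_le n (t : nat -> R) :
  t 0%N = 0 -> (forall j, (j < n)%N -> t j < t j.+1) -> t n <= T ->
  (\int[P]_w (\sum_(j < n) (L (t j.+1) w - L (t j) w) ^+ 2)%:E < +oo)%E ->
  (\int[P]_w (\sum_(j < n) (L (t j.+1) w - L (t j) w) ^+ 2)%:E <=
   6%:E + 8%:E * \int[P]_w ((L (t n) w - L 0 w) ^+ 2)%:E)%E.
Proof.
move=> t0 t_inc tnT.
pose V w := \sum_(j < n) (L (t j.+1) w - L (t j) w) ^+ 2.
rewrite -[(\int[P]_w (\sum_(j < n) _)%:E)%E]/(\int[P]_w (V w)%:E)%E.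
have tT j : (j <= n)%N -> 0 <= t j <= T.
  have t_nd k l : (k <= l <= n)%N -> t k <= t l.
    elim: l => [|l IHl]; first by rewrite leqn0 => /andP[/eqP ->].
    case/andP; rewrite leq_eqVlt => /predU1P[->//|]; rewrite ltnS => kl ln.
    by rewrite (le_trans (IHl _)) ?kl ?(ltnW ln)// ltW// t_inc.
  move=> jn; rewrite -{1}t0 t_nd ?leq0n// (le_trans _ tnT)// t_nd//.
  by rewrite jn leqnn.
pose y w j := L (t j) w - L 0 w.
have y0 w : y w 0%N = 0 by rewrite /y t0 subrr.
have yB w j : y w j.+1 - y w j = L (t j.+1) w - L (t j) w by rewrite /y; ring.
have my j : (j <= n)%N -> measurable_fun setT (y ^~ j).
  move=> jn; apply: measurable_funB; apply: measurable_log; first exact: tT.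
  by have := tT 0%N (leq0n n); rewrite t0.
have mVj (j : 'I_n) :
    measurable_fun setT (fun w => (L (t j.+1) w - L (t j) w) ^+ 2).
  apply: measurable_funX; apply: measurable_funB; apply: measurable_log;
    apply: tT => //; exact: ltnW.
have mV : measurable_fun setT V by exact: measurable_sum.
have V0 w : 0 <= V w by apply: sumr_ge0 => j _; exact: sqr_ge0.
have mweight : measurable_fun [set: R] weight.
  apply: measurable_funD => //; apply: measurable_funM => //.
move=> Voo.
have mW (j : 'I_n) : measurable_fun setT (fun w => weight (y w j)).
  by apply: measurableT_comp => //; apply: my; exact: ltnW.
have mE (j : 'I_n) : measurable_fun setT
    (fun w => weight (y w j) * expR (y w j.+1 - y w j)).
  apply: measurable_funM => //; apply: measurableT_comp => //.
  by apply: measurable_funB; apply: my => //; exact: ltnW.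
have W0 w j : 0 <= weight (y w j) by exact: weight_ge0.
have E0 w j : 0 <= weight (y w j) * expR (y w j.+1 - y w j).
  by rewrite mulr_ge0// expR_ge0.
(* Dominate by 12 + 4 n + 4 V. The dependence on n is harmless, since these integrals only have to
   be finite in order to cancel. *)
have Woo (j : 'I_n) : (\int[P]_w (weight (y w j))%:E < +oo)%E.
  apply: (@le_lt_trans _ _
      (\int[P]_w ((12 + 4 * n%:R)%:E + 4%:E * (V w)%:E))%E).
    apply: ge0_le_integral => //.
    - by move=> w _; rewrite lee_fin.
    - exact/measurable_EFinP.
    - apply: emeasurable_funD => //; apply: measurable_funeM.
      exact/measurable_EFinP.
    move=> w _; rewrite -EFinM -EFinD lee_fin /weight.
    have := le_normr_sum_sq_increments (y0 w) (ltnW (ltn_ord j)).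
    under eq_bigr do rewrite yB.
    rewrite -/(V w); lra.
  rewrite ge0_integralD//; last 2 first.
  - by move=> w _; rewrite mule_ge0// lee_fin.
  - by apply: measurable_funeM; exact/measurable_EFinP.
  rewrite integral_cst//= probability_setT mule1 ge0_integralZl_EFin//; last 2 first.
  - by move=> w _; rewrite lee_fin.
  - exact/measurable_EFinP.
  rewrite lte_add_pinfty// ?ltry// lte_mul_pinfty// lee_fin.
have main : (\int[P]_w (V w + \sum_(j < n) weight (y w j))%:E <=
  \int[P]_w ((6 + 8 * y w n ^+ 2) +
             \sum_(j < n) weight (y w j) * expR (y w j.+1 - y w j))%:E)%E.
  apply: ge0_le_integral => //.
  - by move=> w _; rewrite lee_fin addr_ge0// sumr_ge0.
  - apply/measurable_EFinP; apply: measurable_funD => //.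
    exact: measurable_sum.
  - apply/measurable_EFinP; apply: measurable_funD; last exact: measurable_sum.
    apply: measurable_funD => //; apply: measurable_funM => //.
    by apply: measurable_funX; exact: my.
  move=> w _; rewrite lee_fin.
  have := sum_sq_increments_potential n (y0 w).
  by under eq_bigr do rewrite yB.
have myn : measurable_fun setT (fun w => (y w n ^+ 2)%:E).
  by apply/measurable_EFinP; apply: measurable_funX; exact: my.
have W_fin : (\sum_(j < n) \int[P]_w (weight (y w j))%:E)%E \is a fin_num.
  rewrite ge0_fin_numE; first by apply: lte_sum_pinfty => j _; exact: Woo.
  by apply: sume_ge0 => j _; apply: integral_ge0 => w _; rewrite lee_fin.
(* Add the finite sum of expected weights to both sides, which brings the goal to the form of
   [main]. *)
rewrite -(leeD2rE _ _ W_fin).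
rewrite -ge0_integralD_sum// (le_trans main)// ge0_integralD_sum//; last 2 first.
- apply: measurable_funD => //; apply: measurable_funM => //.
  by apply: measurable_funX; exact: my.
- by move=> w; rewrite addr_ge0// mulr_ge0// sqr_ge0.
apply: leeD.
  under eq_integral do rewrite EFinD EFinM.
  rewrite ge0_integralD//; last 2 first.
  - by move=> w _; rewrite mule_ge0// lee_fin sqr_ge0.
  - exact: measurable_funeM.
  rewrite integral_cst//= probability_setT mule1 ge0_integralZl_EFin//.
  by move=> w _; rewrite lee_fin sqr_ge0.
apply: lee_sum => j _.
under eq_integral do rewrite yB.
apply: integral_expR_increment_le => //.
- by have /andP[] := tT j (ltnW (ltn_ord j)).
- exact: t_inc.
- by have /andP[] := tT j.+1 (ltn_ord j).
- exact: weight_ge0.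
Qed.

End log_increments.

(** * The uniform grid and the final constant *)

Theorem theorem3 (R : realType) (d : measure_display) (Omega : measurableType d)
  (P : probability Omega R) (T : R) (F : R -> set (set Omega))
  (S Q : R -> Omega -> R)
  (T_gt0 : 0 < T)
  (F_filtration : is_filtration T F)
  (F_usual : usual_conditions P T F)
  (S_semimartingale : semimartingale P T F S)
  (S_local_martingale : local_martingale P T F S)
  (S_gt0 : {ae P, forall w, forall t, 0 <= t <= T -> 0 < S t w})
  (Sleft_gt0 : {ae P, forall w, forall t, 0 < t <= T -> 0 < left_limit S t w})
  (Q_quadvar : is_quadratic_variation P T F (fun t w => ln (S t w)) Q)
  (QT_L1 : P.-integrable setT (EFin \o Q T))
  (Pn_L1 : forall n : nat, (1 <= n)%N ->
     P.-integrable setT (EFin \o realized_variance T S n)) :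
  exists2 C : R, 0 < C &
    forall n : nat, (1 <= n)%N ->
      (`|'E_P[Q T] - 'E_P[realized_variance T S n]| <= C%:E)%E.
Proof.
(* [V] is [realized_variance] with the index shifted to start at 0 and the log ratios split into
   differences; the two agree where S > 0 on [0, T], hence almost surely. *)
pose V n w := \sum_(j < n)
  (ln (S (j.+1%:R * T / n%:R) w) - ln (S (j%:R * T / n%:R) w)) ^+ 2.
have grid_end n : (0 < n)%N -> n%:R * T / n%:R = T.
  by move=> n0; rewrite mulrAC mulfV ?mul1r// pnatr_eq0 -lt0n.
have mln t : 0 <= t <= T -> measurable_fun setT (fun w => ln (S t w)).
  exact: (measurable_log F_filtration S_local_martingale).
have grid_itv n j : (j <= n)%N -> (0 < n)%N -> 0 <= j%:R * T / n%:R <= T.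
  move=> jn n0; rewrite divr_ge0 ?mulr_ge0 ?ler0n ?(ltW T_gt0)//=.
  by rewrite ler_pdivrMr ?ltr0n// mulrC ler_wpM2l ?ler_nat// ltW.
have mV n : (0 < n)%N -> measurable_fun setT (V n).
  move=> n0; apply: measurable_sum => j; apply: measurable_funX.
  by apply: measurable_funB; apply: mln; apply: grid_itv => //; exact: ltnW.
have EV n : (0 < n)%N -> 
    ('E_P[realized_variance T S n] = \int[P]_w (V n w)%:E)%E.
  move=> n0; rewrite unlock; apply: ae_eq_integral => //.
  - by have /integrableP[] := Pn_L1 n n0.
  - by apply/measurable_EFinP; exact: mV.
  apply: filterS S_gt0 => w Sw _; congr EFin.
  rewrite /realized_variance /V big_add1 big_mkord; apply: eq_bigr => j _ /=.
  by rewrite ln_div// posrE Sw// grid_itv// ltnW.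
have EV_fin n : (0 < n)%N -> (\int[P]_w (V n w)%:E)%E \is a fin_num.
  by move=> n0; rewrite -EV// unlock; exact/integrable_fin_num/Pn_L1.
have EV_ge0 n : (0 <= \int[P]_w (V n w)%:E)%E.
  by apply: integral_ge0 => w _; rewrite lee_fin sumr_ge0// => j _; exact: sqr_ge0.
(* The end term (L_T - L_0)^2 is the realized variance for n = 1, so the bound is finite and the
   same for all n. *)
have EV_le n : (0 < n)%N ->
    (\int[P]_w (V n w)%:E <= 6%:E + 8%:E * \int[P]_w (V 1%N w)%:E)%E.
  move=> n0.
  have := @integral_sum_sq_increments_le _ _ _ P T F S F_filtration
    S_local_martingale S_gt0 n (fun j => j%:R * T / n%:R).
  rewrite !mul0r grid_end// => /(_ erefl) incr.
  rewrite [X in (_ <= 6%:E + 8%:E * X)%E](_ : _ =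
    \int[P]_w ((ln (S T w) - ln (S 0 w)) ^+ 2)%:E)%E.
    apply: incr => //.
    + by move=> j _; rewrite ltr_pM2r ?invr_gt0 ?ltr0n// ltr_pM2r// ltr_nat.
    + by rewrite ltey_eq EV_fin.
  by apply: eq_integral => w _; rewrite /V big_ord1 !mul0r mul1r divr1.
have EQ_fin : 'E_P[Q T]%E \is a fin_num.
  by rewrite unlock; exact/integrable_fin_num.
(* Triangle inequality: |E Q_T| plus the uniform bound [EV_le], where the summand 6 ensures
   positivity. *)
exists (`|fine 'E_P[Q T]%E| + (6 + 8 * fine (\int[P]_w (V 1%N w)%:E)%E)).
  have : 0 <= fine (\int[P]_w (V 1%N w)%:E)%E by exact: fine_ge0.
  by have := normr_ge0 (fine 'E_P[Q T]%E); lra.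
move=> n n0; rewrite EV//.
apply: (le_trans (lee_abs_sub _ _)) => //.
rewrite EFinD leeD//.
  by rewrite -abse_EFin fineK.
by rewrite gee0_abs// (le_trans (EV_le n n0))// [leRHS]EFinD EFinM fineK// EV_fin.
Qed.
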